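(* Let a sensing matrix $A\in\mathbb{R}^{m\times n}$ and a representation structure $\mathcal{S}=(B,n_1,\dots,n_K,\|\cdot\|_{(1)},\dots,\|\cdot\|_{(K)})$ be given. Let $N=n_1+\cdots+n_K$, and let an $N\times N$ matrix $V=[V^{k\ell}]_{k,\ell=1}^K$ (with blocks $V^{k\ell}\in\mathbb{R}^{n_k\times n_\ell}$) and an $m\times N$ matrix $H$ satisfy $$B=VB+H^TA.$$ Denote $$\nu^*_{s,q}(V)=\max_{1\le\ell\le K}\ \max_{w^\ell\in\mathbb{R}^{n_\ell}:\ \|w^\ell\|_{(\ell)}\le1}L_{s,q}\big([V^{1\ell}w^\ell;\dots;V^{K\ell}w^\ell]\big).$$ Then for all positive integers $s\le K$ and all $q\in[1,\infty]$, $$L_{s,q}(Bx)\le s^{1/q}L_\infty(H^TAx)+\nu^*_{s,q}(V)\,L_1(Bx)\qquad\forall x\in\mathbb{R}^n.$$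
   Context: A representation structure (r.s.) $\mathcal{S}=(B,n_1,\dots,n_K,\|\cdot\|_{(1)},\dots,\|\cdot\|_{(K)})$ consists of positive integers $n_1,\dots,n_K$ with $N=n_1+\cdots+n_K$, a matrix $B=[B[1];\dots;B[K]]\in\mathbb{R}^{N\times n}$ (vertical concatenation, $B[k]\in\mathbb{R}^{n_k\times n}$), and norms $\|\cdot\|_{(k)}$ on $\mathbb{R}^{n_k}$. Vectors $w\in\mathbb{R}^N=\mathbb{R}^{n_1}\times\cdots\times\mathbb{R}^{n_K}$ are written in blocks $w=[w[1];\dots;w[K]]$, $w[k]\in\mathbb{R}^{n_k}$; the magnitude of block $k$ is $\|w[k]\|_{(k)}$. For $1\le p\le\infty$, $L_p(w)=\|[\|w[1]\|_{(1)};\dots;\|w[K]\|_{(K)}]\|_p$. The vector $w^s$ is obtained from $w$ by zeroing out all but the $s$ blocks largest in magnitude (ties resolved arbitrarily), and $L_{s,p}(w)=L_p(w^s)$. Convention: $1/\infty=0$. *)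

(* Defs.v *)
From mathcomp Require Import all_boot all_order all_algebra.
From mathcomp Require Import all_classical all_reals all_analysis.
Set Implicit Arguments.
Unset Strict Implicit.
Unset Printing Implicit Defensive.
Import Order.TTheory GRing.Theory Num.Theory.
Local Open Scope classical_set_scope.
Local Open Scope ring_scope.

(* An arbitrary norm on R^n, unrelated to the canonical (max) norm `|x| that
   the library puts on matrices. *)
Record is_norm (R : realType) (n : nat) (f : 'cV[R]_n -> R) : Prop := IsNorm {
  is_norm_triangle : forall x y, f (x + y) <= f x + f y;
  is_norm_homogeneous : forall (a : R) x, f (a *: x) = `|a| * f x;
  is_norm_definite : forall x, f x = 0 -> x = 0 }.

Record repr_struct (R : realType) (n K : nat) : Type := ReprStruct {
  rs_dim : 'I_K -> nat;
  rs_dim_gt0 : forall k, (0 < rs_dim k)%N;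
  rs_mx : 'M[R]_((\sum_(k < K) rs_dim k)%N, n);
  rs_norm : forall k, 'cV[R]_(rs_dim k) -> R;
  rs_normP : forall k, is_norm (@rs_norm k) }.
Arguments rs_norm {R n K} r k _.

Notation rs_size S := (\sum_(k < _) rs_dim S k)%N.

(* Only 1 <= p is meaningful; the value at -oo is junk. *)
Definition lp_norm (R : realType) (K : nat) (p : \bar R) (u : 'cV[R]_K) : R :=
  match p with
  | EFin r => (\sum_(k < K) `|u k 0| `^ r) `^ r^-1
  | +oo%E => \big[Order.max/0]_(k < K) `|u k 0|
  | -oo%E => 0
  end.

Definition block_mag (R : realType) (n K : nat) (S : repr_struct R n K)
    (w : 'cV[R]_(rs_size S)) : 'cV[R]_K :=
  \col_k rs_norm S k (submxcol w k).

Definition block_lp (R : realType) (n K : nat) (S : repr_struct R n K)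
    (p : \bar R) (w : 'cV[R]_(rs_size S)) : R :=
  lp_norm p (block_mag w).

(* [pick] resolves ties. No such set exists if s > K, and then all the blocks
   are kept. *)
Definition largest_blocks (R : realType) (n K : nat) (S : repr_struct R n K)
    (s : nat) (w : 'cV[R]_(rs_size S)) : {set 'I_K} :=
  odflt [set: 'I_K]%SET
    [pick I : {set 'I_K} | (#|I| == s) &&
      [forall i in I, forall j in ~: I, block_mag w j 0 <= block_mag w i 0]].

Definition block_trunc (R : realType) (n K : nat) (S : repr_struct R n K)
    (s : nat) (w : 'cV[R]_(rs_size S)) : 'cV[R]_(rs_size S) :=
  \mxcol_k (if k \in largest_blocks s w then submxcol w k else 0).

Definition block_slp (R : realType) (n K : nat) (S : repr_struct R n K)
    (s : nat) (p : \bar R) (w : 'cV[R]_(rs_size S)) : R :=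
  block_lp p (block_trunc s w).

(* The inner maximum, attained by compactness of the unit ball, is written as a
   supremum; the neutral element 0 of the outer one is harmless as the values
   of block_slp are nonnegative. *)
Definition nu_star (R : realType) (n K : nat) (S : repr_struct R n K)
    (s : nat) (q : \bar R) (V : 'M[R]_(rs_size S)) : R :=
  \big[Order.max/0]_(l < K)
    sup [set block_slp s q (\mxcol_k (submxblock V k l *m w))
        | w in [set w : 'cV[R]_(rs_dim S l) | rs_norm S l w <= 1]].

(* Main.v *)
Require Import Defs.
From mathcomp Require Import all_boot all_order all_algebra.
From mathcomp Require Import all_classical all_reals all_analysis.
From mathcomp Require Import ring.
Import Order.TTheory GRing.Theory Num.Theory.
Import numFieldNormedType.Exports.
Local Open Scope classical_set_scope.
Local Open Scope ring_scope.
Set Implicit Arguments.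
Unset Strict Implicit.
Unset Printing Implicit Defensive.

(** Put w = B x, so that w = H^T A x + V w, and let I be the set of the s blocks
that the truncation of w keeps. Keeping the blocks of I and then taking L_q is a
seminorm g_I ([restricted_lp_seminorm]), because l_q is a norm that is monotone
in the moduli of the coordinates; this contains the Minkowski inequality
([lp_norm_minkowski]). Unlike L_{s,q}, whose set of blocks moves with the
argument, g_I can be split along sums:

  L_{s,q}(w) = g_I(w) <= g_I(H^T A x) + sum_l g_I(V[., l] w[l]).

The first term has at most s nonzero magnitudes, each at most
L_oo(H^T A x), whence the factor s^(1/q) ([lp_norm_keep_le]). For the others, s
blocks of largest magnitude give the largest l_q norm among all sets of s blocks
([lp_norm_keep_dominant]), so g_I <= L_{s,q}; normalising w[l] to the unit
sphere then gives g_I(V[., l] w[l]) <= nu* ||w[l]||_(l)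
([restricted_lp_nu_star]), and the right-hand sides add up to nu* L_1(w).

The last step needs the supremum that defines nu* to be a genuine upper bound,
that is, the values of L_{s,q} on the image of the unit ball must be bounded.
This is the fact that on R^d any seminorm is bounded by a multiple of any norm
([seminorm_le_norm]), which rests on the compactness of the unit sphere. *)

(** * Seminorms on real vector spaces *)

Record is_seminorm (R : realType) (V : lmodType R) (f : V -> R) : Prop :=
  IsSeminorm {
    seminorm_triangle : forall x y, f (x + y) <= f x + f y;
    seminorm_homogeneous : forall (a : R) x, f (a *: x) = `|a| * f x }.
Arguments seminorm_triangle {R V f}.
Arguments seminorm_homogeneous {R V f}.

Lemma seminorm_of_norm (R : realType) (n : nat) (f : 'cV[R]_n -> R) :
  is_norm f -> is_seminorm f.
Proof. by case. Qed.

Lemma seminorm_comp_linear (R : realType) (U V : lmodType R) (f : V -> R)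
    (g : {linear U -> V}) : is_seminorm f -> is_seminorm (f \o g).
Proof.
move=> [fD fZ]; split=> [x y|a x] /=; first by rewrite linearD fD.
by rewrite linearZ fZ.
Qed.

Lemma seminorm0 (R : realType) (V : lmodType R) (f : V -> R) :
  is_seminorm f -> f 0 = 0.
Proof. by move=> fS; rewrite -(scale0r 0) (seminorm_homogeneous fS) normr0 mul0r. Qed.

Lemma seminormN (R : realType) (V : lmodType R) (f : V -> R) (x : V) :
  is_seminorm f -> f (- x) = f x.
Proof.
by move=> fS; rewrite -scaleN1r (seminorm_homogeneous fS) normrN1 mul1r.
Qed.

Lemma seminorm_ge0 (R : realType) (V : lmodType R) (f : V -> R) (x : V) :
  is_seminorm f -> 0 <= f x.
Proof.
move=> fS; have := seminorm_triangle fS x (- x).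
by rewrite subrr (seminorm0 fS) (seminormN _ fS) -mulr2n pmulrn_lge0.
Qed.

Lemma seminorm_sum (R : realType) (V : lmodType R) (f : V -> R) (I : finType)
    (x : I -> V) :
  is_seminorm f -> f (\sum_i x i) <= \sum_i f (x i).
Proof.
move=> fS; apply: (big_ind2 (fun a b => f a <= b)) => [|a b c d ab cd|//].
  by rewrite seminorm0.
exact: le_trans (seminorm_triangle fS _ _) (lerD ab cd).
Qed.

Lemma seminorm_distance (R : realType) (V : lmodType R) (f : V -> R) (x y : V) :
  is_seminorm f -> `|f x - f y| <= f (x - y).
Proof.
move=> fS; rewrite ler_distl; apply/andP; split.
  have := seminorm_triangle fS x (y - x); rewrite addrC subrK.
  by rewrite -(seminormN (y - x) fS) opprB lerBlDr.
by have := seminorm_triangle fS (x - y) y; rewrite subrK addrC.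
Qed.

(** * Comparison of norms in finite dimension *)

(** Expand x in the standard basis. The summand 1 keeps the constant positive, so
that one can divide by it when d = 0 or f = 0. *)
Lemma seminorm_le_mx_norm (R : realType) (d : nat) (f : 'rV[R]_d -> R) :
  is_seminorm f -> exists2 C, 0 < C & forall x, f x <= C * `|x|.
Proof.
move=> fS; exists (1 + \sum_i f (delta_mx 0 i)) => [|x].
  by rewrite ltr_pwDl ?sumr_ge0// => i _; exact: seminorm_ge0.
rewrite {1}(row_sum_delta x) mulrDl mul1r.
apply: le_trans (seminorm_sum _ fS) _.
rewrite -[leLHS]add0r lerD// mulr_suml ler_sum// => i _.
rewrite (seminorm_homogeneous fS) mulrC ler_wpM2l ?seminorm_ge0//.
by rewrite [leRHS]/Num.norm/= mx_normrE;
  exact: (le_bigmax _ (fun i => `|x i.1 i.2|) (0, i)).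
Qed.

Lemma seminorm_continuous (R : realType) (d : nat) (f : 'rV[R]_d -> R) :
  is_seminorm f -> continuous f.
Proof.
move=> fS; have [C C0 fC] := seminorm_le_mx_norm fS.
move=> x; apply/(@cvgrPdist_le _ _ _ (nbhs x) (nbhs_filter x)) => e e0.
apply/(@nbhs_normP R 'rV[R]_d x).
exists (e / C); first exact: divr_gt0.
move=> y; rewrite /ball_/= ltr_pdivlMr// mulrC => xy.
exact: le_trans (seminorm_distance _ _ fS) (le_trans (fC _) (ltW xy)).
Qed.

(** The minimum of f on the unit sphere of the max norm is attained by
compactness, hence positive by definiteness; homogeneity does the rest. *)
Lemma norm_ge_mx_norm (R : realType) (d : nat) (f : 'rV[R]_d -> R) :
  is_seminorm f -> (forall x, f x = 0 -> x = 0) ->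
  exists2 c, 0 < c & forall x, c * `|x| <= f x.
Proof.
move=> fS f_def; pose sph : set 'rV[R]_d := [set x | `|x| = 1].
have sphP (x : 'rV[R]_d) : x != 0 -> sph (`|x|^-1 *: x).
  by move=> x0; rewrite /sph/= normrZ normfV normr_id mulVf ?normr_eq0.
(* The sphere is empty when d = 0. *)
have [sph0|/set0P sph0] := eqVneq sph set0.
  exists 1 => // x; have [->|/sphP] := eqVneq x 0; last by rewrite sph0.
  by rewrite normr0 mulr0 seminorm_ge0.
have sph_compact : compact sph.
  apply: bounded_closed_compact.
    by exists 1; split=> // M M1 x /= ->; exact: ltW.
  have -> : sph = Num.norm @^-1` [set 1 : R] by [].
  by apply: closed_comp => [x _|]; [exact: norm_continuous|exact: closed_eq].
have [c c_sph c_min] := compact_EVT_min sph0 sph_compact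
  (continuous_subspaceT (seminorm_continuous fS)).
have fc0 : 0 < f c.
  rewrite lt_def seminorm_ge0// andbT; apply/eqP => /f_def c0.
  by move: c_sph; rewrite inE /sph/= c0 normr0 => /esym/eqP; rewrite oner_eq0.
exists (f c) => // x; have [->|x0] := eqVneq x 0.
  by rewrite normr0 mulr0 seminorm_ge0.
have := c_min _ (mem_set (sphP x x0)).
by rewrite (seminorm_homogeneous fS) normfV normr_id mulrC ler_pdivlMr ?normr_gt0.
Qed.

(** Both f and g are compared with the max norm. The compactness argument is
carried out on row vectors, so f and g are first transposed. *)
Lemma seminorm_le_norm (R : realType) (d : nat) (f g : 'cV[R]_d -> R) :
  is_norm f -> is_seminorm g -> exists2 C, 0 <= C & forall x, g x <= C * f x.
Proof.
move=> fN gS.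
have trS h (hS : is_seminorm h) : is_seminorm (fun x : 'rV[R]_d => h x^T).
  exact: (seminorm_comp_linear (@trmx R 1 d : {linear _ -> _}) hS).
have [C C0 gC] := seminorm_le_mx_norm (trS g gS).
have fT_def (x : 'rV[R]_d) : f x^T = 0 -> x = 0.
  by move/(is_norm_definite fN) => x0; rewrite -[x]trmxK x0 trmx0.
have [c c0 fc] := norm_ge_mx_norm (trS f (seminorm_of_norm fN)) fT_def.
exists (C / c) => [|x]; first by rewrite divr_ge0 ?ltW.
have := gC x^T; rewrite trmxK => /le_trans; apply.
rewrite -mulrA ler_pM2l// mulrC ler_pdivlMr// mulrC.
by have := fc x^T; rewrite trmxK.
Qed.

(** * The l_p norms on R^K *)

Lemma powR_invK (R : realType) (r a : R) : r != 0 -> 0 <= a ->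
  (a `^ r) `^ r^-1 = a.
Proof. by move=> r0 a0; rewrite -powRrM divff// powRr1. Qed.

(** The convexity inequality behind the Minkowski inequality: (a + b) / (c + d)
is the barycentre of a / c and b / d with weights proportional to c and d, and
t |-> t^r is convex. *)
Lemma powRD_le (R : realType) (r a b c d : R) : 1 <= r ->
  0 <= a -> 0 <= b -> 0 < c -> 0 < d ->
  (a + b) `^ r <=
    (c + d) `^ r * (c / (c + d) * (a / c) `^ r + d / (c + d) * (b / d) `^ r).
Proof.
move=> r1 a0 b0 c0 d0; have cd0 : 0 < c + d by exact: addr_gt0.
have t0 : 0 <= c / (c + d) by rewrite divr_ge0 ?ltW.
have t1 : c / (c + d) <= 1 by rewrite ler_pdivrMr// mul1r lerDl ltW.
have := @convex_powR _ _ r1 (Itv01 t0 t1) (a / c) (b / d).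
rewrite !inE/= !in_itv/= !andbT !divr_ge0 ?(ltW c0) ?(ltW d0)// => /(_ isT isT).
rewrite -[leLHS]/((c / (c + d) * (a / c) + (1 - c / (c + d)) * (b / d)) `^ r).
rewrite -[leRHS]/(c / (c + d) * (a / c) `^ r + (1 - c / (c + d)) * (b / d) `^ r).
have -> : 1 - c / (c + d) = d / (c + d) by field; rewrite gt_eqF.
have -> : c / (c + d) * (a / c) + d / (c + d) * (b / d) = (a + b) / (c + d).
  by field; rewrite !gt_eqF.
move=> cvx; have {1}-> : a + b = (c + d) * ((a + b) / (c + d)).
  by rewrite mulrC divfK// gt_eqF.
by rewrite [leLHS]powRM ?divr_ge0 ?(ltW cd0) ?addr_ge0// ler_wpM2l// powR_ge0.
Qed.

(** The value -oo being excluded by q >= 1, claims about l_q reduce to a claim about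
power sums and one about maxima. *)
Lemma exponent_ind (R : realType) (P : \bar R -> Prop) :
  (forall r : R, 1 <= r -> P r%:E) -> P +oo%E ->
  forall q, (1%:E <= q)%E -> P q.
Proof.
by move=> Pfin Poo [r| |]; [rewrite lee_fin; exact: Pfin | | rewrite leeNy_eq].
Qed.

Lemma lp_norm_le (R : realType) (K : nat) (q : \bar R) (u v : 'cV[R]_K) :
  (1%:E <= q)%E -> (forall k, `|u k 0| <= `|v k 0|) ->
  lp_norm q u <= lp_norm q v.
Proof.
move=> q1 uv; move: q q1; apply: exponent_ind => [r r1|].
  have r0 : 0 <= r by exact: le_trans r1.
  rewrite /= ge0_ler_powR ?invr_ge0 ?nnegrE ?sumr_ge0// ler_sum// => k _.
  by rewrite ge0_ler_powR ?nnegrE.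
apply: bigmax_le => [|k _]; first exact: bigmax_ge_id.
exact: le_trans (uv k) (le_bigmax _ (fun k => `|v k 0|) k).
Qed.

(** Apply [powRD_le] to each coordinate, with c and d the norms of u and v: after
summation the normalised vectors u / c and v / d contribute exactly 1, so the two
weights add up to 1. *)
Lemma lp_norm_minkowski (R : realType) (K : nat) (r : R) (u v : 'cV[R]_K) :
  1 <= r -> lp_norm r%:E (u + v) <= lp_norm r%:E u + lp_norm r%:E v.
Proof.
move=> r1; have r0 : 0 < r by exact: lt_le_trans r1.
have lp_ge0 (w : 'cV[R]_K) : 0 <= lp_norm r%:E w by exact: powR_ge0.
have lp_powR (w : 'cV[R]_K) : lp_norm r%:E w `^ r = \sum_k `|w k 0| `^ r.
  by rewrite /= -powRrM mulVf ?gt_eqF// powRr1// sumr_ge0.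
have lp_eq0 (w : 'cV[R]_K) : lp_norm r%:E w = 0 -> w = 0.
  move=> w0; apply/colP => k; rewrite mxE.
  have := lp_powR w; rewrite w0 powR0 ?gt_eqF// => /esym.
  move/psumr_eq0P => /(_ (fun k _ => powR_ge0 _ _)) /(_ k isT) /powR_eq0_eq0.
  exact: normr0_eq0.
have [u0|u0] := eqVneq (lp_norm r%:E u) 0.
  by rewrite u0 (lp_eq0 _ u0) !add0r.
have [v0|v0] := eqVneq (lp_norm r%:E v) 0.
  by rewrite v0 (lp_eq0 _ v0) !addr0.
have {u0}F0 : 0 < lp_norm r%:E u by rewrite lt_def u0 lp_ge0.
have {v0}G0 : 0 < lp_norm r%:E v by rewrite lt_def v0 lp_ge0.
move: F0 G0 (lp_powR u) (lp_powR v).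
set F := lp_norm r%:E u; set G := lp_norm r%:E v => F0 G0 FE GE.
clearbody F G.
rewrite /= -[leRHS](@powR_invK _ r) ?gt_eqF ?(ltW (addr_gt0 F0 G0))//.
rewrite ge0_ler_powR ?invr_ge0 ?nnegrE ?powR_ge0 ?sumr_ge0 ?(ltW r0)//.
have normalized (w : 'cV[R]_K) (L : R) : 0 < L -> L `^ r = \sum_k `|w k 0| `^ r ->
    \sum_k (`|w k 0| / L) `^ r = 1.
  move=> L0 LE; under eq_bigr do rewrite powRM ?invr_ge0 ?(ltW L0)//.
  rewrite -mulr_suml -LE -powRM ?invr_ge0 ?(ltW L0)// divff ?gt_eqF//.
  by rewrite powR1.
have pointwise k : `|(u + v) k 0| `^ r <= (F + G) `^ r *
    (F / (F + G) * (`|u k 0| / F) `^ r + G / (F + G) * (`|v k 0| / G) `^ r).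
  apply: le_trans (powRD_le r1 (normr_ge0 _) (normr_ge0 _) F0 G0).
  by rewrite ge0_ler_powR ?nnegrE ?(ltW r0)// ?addr_ge0// mxE ler_normD.
apply: le_trans (ler_sum _ (fun k _ => pointwise k)) _.
rewrite -mulr_sumr big_split/= -mulr_sumr -mulr_sumr.
rewrite (normalized _ _ F0 FE) (normalized _ _ G0 GE) !mulr1 -mulrDl.
by rewrite divff ?mulr1// gt_eqF// addr_gt0.
Qed.

Lemma lp_norm_seminorm (R : realType) (K : nat) (q : \bar R) :
  (1%:E <= q)%E -> is_seminorm (lp_norm q : 'cV[R]_K -> R).
Proof.
move: q; apply: exponent_ind => [r r1|]; split=> [u v|a u].
- exact: lp_norm_minkowski.
- have r0 : 0 < r by exact: lt_le_trans r1.
  rewrite /=; under eq_bigr do rewrite mxE normrM powRM//.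
  by rewrite -mulr_sumr powRM ?powR_ge0 ?sumr_ge0// powR_invK ?gt_eqF.
- apply: bigmax_le => [|k _]; first by rewrite addr_ge0 ?bigmax_ge_id.
  rewrite mxE; apply: le_trans (ler_normD _ _) (lerD _ _).
    exact: (le_bigmax _ (fun k => `|u k 0|)).
  exact: (le_bigmax _ (fun k => `|v k 0|)).
- rewrite /= (@big_morph _ _ (fun y => `|a| * y) 0 Order.max) ?mulr0//.
    by apply: eq_bigr => k _; rewrite mxE normrM.
  by move=> y z; rewrite maxr_pMr.
Qed.

(** * Keeping the largest coordinates *)

Definition keep_coords (R : realType) (K : nat) (I : {set 'I_K}) (u : 'cV[R]_K) :
  'cV[R]_K := \col_k (if k \in I then u k 0 else 0).

Lemma lp_norm_keep_le (R : realType) (K : nat) (q : \bar R) (I : {set 'I_K})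
    (u : 'cV[R]_K) : (1%:E <= q)%E ->
  lp_norm q (keep_coords I u) <= #|I|%:R `^ fine (q^-1)%E * lp_norm +oo%E u.
Proof.
move: q; apply: exponent_ind => [r r1|].
  have r0 : 0 < r by exact: lt_le_trans r1.
  rewrite fine_invr; set M := lp_norm +oo%E u.
  have M0 : 0 <= M by exact: bigmax_ge_id.
  rewrite -[X in _ * X](@powR_invK _ r) ?gt_eqF// -powRM ?powR_ge0//=.
  rewrite ge0_ler_powR ?invr_ge0 ?nnegrE ?mulr_ge0 ?sumr_ge0 ?powR_ge0 ?(ltW r0)//.
  rewrite mulr_natl -sumr_const [leRHS]big_mkcond ler_sum// => k _.
  rewrite mxE; case: ifP => _; last by rewrite normr0 powR0 ?gt_eqF.
  rewrite ge0_ler_powR ?nnegrE ?(ltW r0)//.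
  exact: (le_bigmax _ (fun k => `|u k 0|)).
rewrite invey/= powRr0 mul1r.
apply: bigmax_le => [|k _]; first exact: bigmax_ge_id.
rewrite mxE; case: ifP => _; last by rewrite normr0 bigmax_ge_id.
exact: (le_bigmax _ (fun k => `|u k 0|)).
Qed.

Definition dominant (R : realType) (K : nat) (u : 'cV[R]_K) (I : {set 'I_K}) :=
  [forall i in I, forall j in ~: I, u j 0 <= u i 0].

Lemma dominantP (R : realType) (K : nat) (u : 'cV[R]_K) (I : {set 'I_K}) :
  reflect (forall i j, i \in I -> j \notin I -> u j 0 <= u i 0) (dominant u I).
Proof.
apply: (iffP forall_inP) => [h i j iI jI|h i iI].
  by have /forall_inP := h i iI; apply; rewrite inE.
by apply/forall_inP => j; rewrite inE; exact: h.
Qed.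

(** Greedy choice: enlarge a dominant set of s coordinates by a largest coordinate
outside it. *)
Lemma dominant_exists (R : realType) (K : nat) (u : 'cV[R]_K) (s : nat) :
  (s <= K)%N -> exists I : {set 'I_K}, (#|I| == s) && dominant u I.
Proof.
elim: s => [_|s IHs sK].
  by exists finset.set0; rewrite cards0; apply/dominantP => i; rewrite inE.
have [I /andP[/eqP Is /dominantP Idom]] := IHs (ltnW sK).
have /card_gt0P[j0 /[!inE] j0I] : (0 < #|~: I|)%N.
  by rewrite -(ltn_add2l #|I|) addn0 cardsC card_ord Is.
case: (@arg_maxP _ _ _ j0 (fun k => k \notin I) (fun k => u k 0) j0I) => i iI imax.
exists (i |: I)%SET; rewrite cardsU1 iI Is eqxx/=; apply/dominantP => k j.
rewrite !inE negb_or => /predU1P[->|kI] /andP[_ jI]; last exact: Idom.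
exact: imax.
Qed.

(** Let t be the largest coordinate outside I. As I and J have the same size,
subtracting t from every coordinate changes both sums equally; now every term
over I is nonnegative and every term outside I is nonpositive. *)
Lemma dominant_sum_ge (R : realType) (K : nat) (u : 'cV[R]_K)
    (I J : {set 'I_K}) : (forall k, 0 <= u k 0) ->
  #|J| = #|I| -> dominant u I ->
  \sum_(k in J) u k 0 <= \sum_(k in I) u k 0.
Proof.
move=> u0 JI /dominantP Idom.
pose t := \big[Order.max/0]_(k | k \notin I) u k 0.
have shift (L : {set 'I_K}) :
    \sum_(k in L) u k 0 = \sum_(k in L) (u k 0 - t) + t *+ #|L|.
  by rewrite sumrB sumr_const subrK.
rewrite !shift JI lerD2r big_mkcond [leRHS]big_mkcond ler_sum//= => k _.
have [kI|kI] := boolP (k \in I); case: ifP => // _.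
- by rewrite subr_ge0; apply: bigmax_le => // j jI; exact: Idom.
- by rewrite subr_le0; exact: (le_bigmax_cond 0 (fun k => u k 0) kI).
Qed.

(** For finite q, this is [dominant_sum_ge] for the q-th powers of the
coordinates, which are in the same order as the coordinates. *)
Lemma lp_norm_keep_dominant (R : realType) (K : nat) (q : \bar R)
    (u : 'cV[R]_K) (I J : {set 'I_K}) : (1%:E <= q)%E -> (forall k, 0 <= u k 0) ->
  #|J| = #|I| -> dominant u I ->
  lp_norm q (keep_coords J u) <= lp_norm q (keep_coords I u).
Proof.
move=> q1 u0 JI Idom; move: q q1; apply: exponent_ind => [r r1|].
  have r0 : 0 < r by exact: lt_le_trans r1.
  pose ur : 'cV[R]_K := \col_k u k 0 `^ r.
  have keepE (L : {set 'I_K}) :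
      \sum_k `|keep_coords L u k 0| `^ r = \sum_(k in L) ur k 0.
    rewrite [RHS]big_mkcond; apply: eq_bigr => k _; rewrite !mxE.
    by case: ifP => _; rewrite ?ger0_norm ?normr0 ?powR0 ?gt_eqF.
  have ur0 k : 0 <= ur k 0 by rewrite mxE powR_ge0.
  rewrite /= !keepE ge0_ler_powR ?invr_ge0 ?nnegrE ?sumr_ge0 ?(ltW r0)//.
  apply: dominant_sum_ge => //; apply/dominantP => i j iI jI.
  rewrite !mxE ge0_ler_powR ?nnegrE ?(ltW r0)//.
  exact: (dominantP _ _ Idom).
(* q = +oo: each coordinate kept by J is below some coordinate kept by I. *)
apply: bigmax_le => [|j _]; first exact: bigmax_ge_id.
rewrite mxE; case: ifP => jJ; last by rewrite normr0 bigmax_ge_id.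
suff [i iI uij] : exists2 i, i \in I & u j 0 <= u i 0.
  rewrite ger0_norm//; apply: le_trans uij _.
  apply: le_trans (le_bigmax _ (fun k => `|keep_coords I u k 0|) i).
  by rewrite mxE iI ler_norm.
have [jI|jI] := boolP (j \in I); first by exists j.
have /card_gt0P[i iI] : (0 < #|I|)%N by rewrite -JI; apply/card_gt0P; exists j.
by exists i => //; exact: (dominantP _ _ Idom).
Qed.

(** * Block vectors *)

(** The functional L_{s,q} with the set of s blocks chosen in advance: this makes
it subadditive. *)
Definition restricted_lp (R : realType) (n K : nat) (S : repr_struct R n K)
    (I : {set 'I_K}) (q : \bar R) (w : 'cV[R]_(rs_size S)) : R :=
  lp_norm q (keep_coords I (block_mag w)).

Lemma block_mag_ge0 (R : realType) (n K : nat) (S : repr_struct R n K)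
    (w : 'cV[R]_(rs_size S)) (k : 'I_K) : 0 <= block_mag w k 0.
Proof. by rewrite mxE (seminorm_ge0 _ (seminorm_of_norm (rs_normP S k))). Qed.

Lemma block_slpE (R : realType) (n K : nat) (S : repr_struct R n K) (s : nat)
    (q : \bar R) (w : 'cV[R]_(rs_size S)) :
  block_slp s q w = restricted_lp (largest_blocks s w) q w.
Proof.
congr lp_norm; apply/colP => k; rewrite !mxE mxcolK; case: ifP => // _.
exact: seminorm0 (seminorm_of_norm (rs_normP S k)).
Qed.

Lemma largest_blocksP (R : realType) (n K : nat) (S : repr_struct R n K)
    (s : nat) (w : 'cV[R]_(rs_size S)) : (s <= K)%N ->
  #|largest_blocks s w| = s /\ dominant (block_mag w) (largest_blocks s w).
Proof.
move=> sK; rewrite /largest_blocks; case: pickP => [I /andP[/eqP Is Idom]|none].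
  by [].
have [I] := dominant_exists (block_mag w) sK.
by have := none I; rewrite /dominant => ->.
Qed.

Lemma restricted_lp_le_slp (R : realType) (n K : nat) (S : repr_struct R n K)
    (s : nat) (q : \bar R) (I : {set 'I_K}) (w : 'cV[R]_(rs_size S)) :
  (s <= K)%N -> (1%:E <= q)%E -> #|I| = s ->
  restricted_lp I q w <= block_slp s q w.
Proof.
move=> sK q1 Is; have [card_max dom_max] := largest_blocksP w sK.
rewrite block_slpE; apply: lp_norm_keep_dominant => //.
  exact: block_mag_ge0.
by rewrite Is card_max.
Qed.

Lemma restricted_lp_seminorm (R : realType) (n K : nat) (S : repr_struct R n K)
    (I : {set 'I_K}) (q : \bar R) : (1%:E <= q)%E ->
  is_seminorm (restricted_lp I q : 'cV[R]_(rs_size S) -> R).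
Proof.
move=> q1; have lpS := lp_norm_seminorm (R := R) K q1.
have rsS k := seminorm_of_norm (rs_normP S k).
split=> [v w|a w]; rewrite /restricted_lp.
  apply: le_trans (seminorm_triangle lpS _ _); apply: lp_norm_le => // k.
  rewrite !mxE; case: ifP => _; last by rewrite addr0.
  rewrite submxcolD !ger0_norm ?addr_ge0 ?seminorm_ge0//.
  exact: seminorm_triangle.
rewrite -[X in X * _]normr_id -(seminorm_homogeneous lpS); congr lp_norm.
apply/colP => k; rewrite !mxE; case: ifP => _; last by rewrite mulr0.
rewrite -(seminorm_homogeneous (rsS k)); congr rs_norm.
by apply/colP => i; rewrite !mxE.
Qed.

Lemma mulmx_blocks (R : realType) (n K : nat) (S : repr_struct R n K)
    (V : 'M[R]_(rs_size S)) (w : 'cV[R]_(rs_size S)) :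
  V *m w = \sum_l submxrow V l *m submxcol w l.
Proof. by rewrite -{1}[V]submxrowK -{1}[w]submxcolK mul_mxrow_mxcol. Qed.

Lemma mxcol_submxblock_mul (R : realType) (n K : nat) (S : repr_struct R n K)
    (V : 'M[R]_(rs_size S)) (l : 'I_K) (w : 'cV[R]_(rs_dim S l)) :
  \mxcol_k (submxblock V k l *m w) = submxrow V l *m w.
Proof.
rewrite -mxcol_mul; congr (_ *m _).
by rewrite -[RHS]submxcolK; apply: eq_mxcol => k; rewrite submxblockEh.
Qed.

(** The set of blocks kept depends on w, but keeping all of them gives a single
seminorm that dominates, and [seminorm_le_norm] applies to it. *)
Lemma block_slp_image_bounded (R : realType) (n K : nat) (S : repr_struct R n K)
    (s : nat) (q : \bar R) (V : 'M[R]_(rs_size S)) (l : 'I_K) :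
  (1%:E <= q)%E ->
  has_ubound [set block_slp s q (\mxcol_k (submxblock V k l *m w))
             | w in [set w : 'cV[R]_(rs_dim S l) | rs_norm S l w <= 1]].
Proof.
move=> q1.
have totS := seminorm_comp_linear (mulmx (submxrow V l) : {linear _ -> _})
  (restricted_lp_seminorm S [set: 'I_K]%SET q1).
have [C C0 leC] := seminorm_le_norm (rs_normP S l) totS.
exists C => _ [w /= w1 <-]; rewrite mxcol_submxblock_mul block_slpE.
apply: le_trans (_ : C * rs_norm S l w <= C); last by rewrite ler_piMr.
apply: le_trans (leC w); apply: lp_norm_le => // k; rewrite !mxE inE.
by case: ifP => //; rewrite normr0.
Qed.

(** The supremum controls the unit ball only; homogeneity of the fixed-set
seminorm reduces a general w to w / ||w||. *)
Lemma restricted_lp_nu_star (R : realType) (n K : nat) (S : repr_struct R n K)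
    (s : nat) (q : \bar R) (V : 'M[R]_(rs_size S)) (I : {set 'I_K}) (l : 'I_K)
    (w : 'cV[R]_(rs_dim S l)) :
  (s <= K)%N -> (1%:E <= q)%E -> #|I| = s ->
  restricted_lp I q (submxrow V l *m w) <= nu_star s q V * rs_norm S l w.
Proof.
move=> sK q1 Is; have rlS := restricted_lp_seminorm S I q1.
have rsS := seminorm_of_norm (rs_normP S l).
have [/(is_norm_definite (rs_normP S l)) ->|w0] := eqVneq (rs_norm S l w) 0.
  by rewrite mulmx0 (seminorm0 rlS) (seminorm0 rsS) mulr0.
have {}w0 : 0 < rs_norm S l w by rewrite lt_def w0 seminorm_ge0.
pose u := (rs_norm S l w)^-1 *: w.
have u1 : rs_norm S l u <= 1.
  rewrite (seminorm_homogeneous rsS) ger0_norm ?invr_ge0 ?(ltW w0)//.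
  by rewrite mulVf ?gt_eqF.
have -> : submxrow V l *m w = rs_norm S l w *: (submxrow V l *m u).
  by rewrite -scalemxAr scalerA divff ?gt_eqF// scale1r.
rewrite (seminorm_homogeneous rlS) gtr0_norm// mulrC ler_pM2r//.
apply: le_trans (le_bigmax _ _ l).
apply: le_trans (restricted_lp_le_slp (submxrow V l *m u) sK q1 Is) _.
apply: ub_le_sup; first exact: block_slp_image_bounded.
by exists u; rewrite //= mxcol_submxblock_mul.
Qed.

Lemma block_lp1E (R : realType) (n K : nat) (S : repr_struct R n K)
    (w : 'cV[R]_(rs_size S)) :
  block_lp 1%:E w = \sum_k rs_norm S k (submxcol w k).
Proof.
rewrite /block_lp/= invr1 powRr1 ?sumr_ge0//.
apply: eq_bigr => k _; rewrite ger0_norm ?block_mag_ge0// powRr1 ?block_mag_ge0//.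
by rewrite mxE.
Qed.

Unset Implicit Arguments.

(* (q^-1)%E is 0 at q = +oo. *)
Theorem proposition5p1 (R : realType) (m n K : nat) (A : 'M[R]_(m, n))
    (S : repr_struct R n K) (V : 'M[R]_(rs_size S)) (H : 'M[R]_(m, rs_size S))
    (hB : rs_mx S = V *m rs_mx S + H^T *m A) :
  forall (s : nat) (q : \bar R), (0 < s <= K)%N -> (1%:E <= q)%E ->
  forall x : 'cV[R]_n,
    block_slp s q (rs_mx S *m x) <=
      s%:R `^ fine (q^-1)%E * block_lp +oo%E (H^T *m A *m x)
      + nu_star s q V * block_lp 1%:E (rs_mx S *m x).
Proof.
move=> s q /andP[_ sK] q1 x; set w := rs_mx S *m x.
have [card_I _] := largest_blocksP w sK.
rewrite block_slpE; move: (largest_blocks s w) card_I => I card_I.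
have rlS := restricted_lp_seminorm S I q1.
have {1}-> : w = H^T *m A *m x + V *m w.
  by rewrite /w {1}hB mulmxDl addrC mulmxA.
apply: le_trans (seminorm_triangle rlS _ _) (lerD _ _).
  by rewrite -card_I; exact: lp_norm_keep_le.
rewrite mulmx_blocks block_lp1E mulr_sumr.
apply: le_trans (seminorm_sum _ rlS) (ler_sum _ _) => l _.
exact: restricted_lp_nu_star.
Qed.
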